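(* Let $\phi\in\mathcal{A}[\delta,M]$ and $a\in V$. There exists $\Phi:\mathcal{P}[\phi,a]\to\mathcal{C}([0,T],V)$, with increments denoted $\Phi_{s,t}(y):=\Phi(y)_t-\Phi(y)_s$, such that for any partition $\pi$ of $\mathbb{T}$, any $K\ge0$ and any $y\in\mathcal{P}[\phi,a,K]$, $$|\Phi_{s,t}(y)-\widehat{\phi}_{t,s}(y_s)|\le A\,\varpi(\omega_{s,t}),\quad\forall(s,t)\in\mathbb{T}_+^2,$$ $$|\Phi_{s,t}(y)-\Phi^\pi_{s,t}(y)|\le A\,\mu_{s,t}(\pi)\,\omega_{s,t},\quad\forall(s,t)\in\mathbb{T}_+^2,$$ $$\Phi_{r,s}(y)+\Phi_{s,t}(y)=\Phi_{r,t}(y),\quad\forall(r,s,t)\in\mathbb{T}_+^3,$$ with $A:=\dfrac{2(\delta_T(1+K)+M)}{1-\varkappa}$. The second estimate means that $\Phi^\pi$ is consistent.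
   Context: Setting. $V$ is a Banach space with norm $|\cdot|$, $\mathfrak{i}$ is the identity map of $V$, $\mathcal{C}(V,V)$ is the set of continuous maps, $\|f\|_\infty=\sup_a|f(a)|$. $T>0$, $\mathbb{T}=[0,T]$, $\mathbb{T}_+^2=\{(s,t)\in\mathbb{T}^2: s\le t\}$, $\mathbb{T}_+^3=\{(r,s,t)\in\mathbb{T}^3: r\le s\le t\}$. $\delta,\varpi:\mathbb{R}_+\to\mathbb{R}_+$ are non-decreasing with $\delta(0)=\varpi(0)=0$; $\delta_t:=\delta(t)$. $\omega:\mathbb{T}_+^2\to\mathbb{R}_+$ is a control: $\omega_{r,s}+\omega_{s,t}\le\omega_{r,t}$ on $\mathbb{T}_+^3$, $\omega_{s,s}=0$, and $\omega$ is continuous close to its diagonal. Standing assumptions: for some $\varkappa\in(0,1)$, $2\varpi(x/2)\le\varkappa\varpi(x)$ for all $x\ge0$; and $\varkappa+2\delta_T<1$. For $f:V\to V$, $\operatorname{osc}(f,h)=\sup_{|a-b|\le h}|f(a)-f(b)|$. A map $\chi:\mathbb{T}_+^2\to\mathcal{C}(V,V)$, $(s,t)\mapsto\chi_{t,s}$, is of class $\mathcal{O}$ if for some $C\ge0$: $\operatorname{osc}(\chi_{t,s},\ell\varpi(\omega_{r,s}))\le C\delta_T(1+\ell)\varpi(\omega_{r,t})$ for all $(r,s,t)\in\mathbb{T}_+^3$, $\ell\ge0$; the smallest such $C$ is $\|\chi\|_{\mathcal{O}}$. $\mathcal{F}[\delta]$ is the class of families $\phi=\{\phi_{t,s}\}_{(s,t)\in\mathbb{T}_+^2}$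 of maps $V\to V$ with $\phi_{t,s}=\mathfrak{i}+\widehat{\phi}_{t,s}$, $\widehat\phi$ of class $\mathcal{O}$, $\|\widehat\phi\|_{\mathcal{O}}\le1$ and $\|\widehat\phi_{t,s}\|_\infty\le\delta_{t-s}$ for all $(s,t)\in\mathbb{T}_+^2$. For $M\ge0$, $\mathcal{A}[\delta,M]$ is the set of $\phi\in\mathcal{F}[\delta]$ such that $\|\mathfrak{d}\phi_{t,s,r}\|_\infty\le M\varpi(\omega_{r,t})$ on $\mathbb{T}_+^3$, where $\mathfrak{d}\phi_{t,s,r}=\phi_{t,s}\circ\phi_{s,r}-\phi_{t,r}$ (such $\phi$ are called almost flows). $\mathcal{P}[\phi,a,K]$ is the set of $y\in\mathcal{C}(\mathbb{T},V)$ with $y_0=a$ and $|y_t-\phi_{t,s}(y_s)|\le K\varpi(\omega_{s,t})$ for all $(s,t)\in\mathbb{T}_+^2$, and $\mathcal{P}[\phi,a]=\bigcup_{K\ge0}\mathcal{P}[\phi,a,K]$. For a partition $\pi=\{t_i\}_{i=0}^n$ of $\mathbb{T}$ ($0=t_0<\dots<t_n=T$), a path $y$ and points $s=t_i\le t=t_j$ of $\pi$, $\Phi^\pi_{s,t}(y):=\sum_{k=i}^{j-1}\widehat\phi_{t_{k+1},t_k}(y_{t_k})$; using a linear interpolation between points of $\pi$, $\Phi^\pi_{s,t}(y)$ is extended from pairs $s\le t$ of points of $\pi$ to all $(s,t)\in\mathbb{T}_+^2$. Moreover $$\mu_{s,t}(\pi):=\sup_{[t_i,t_{i+1}]\in\pi\cap[s,t]}\frac{\varpi(\omega_{t_i,t_{i+1}})}{\omega_{t_i,t_{i+1}}},$$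 where the elements of a partition are identified with the closed intervals $[t_i,t_{i+1}]$ of successive points.
   Formalization: The second (consistency) estimate is stated only for s ≤ t that are points of π, not for all (s,t) in T_+^2: off the partition points it is false, e.g. for φ_{t,s}(x)=x+f(t)-f(s), f(t)=c√|t-1/10|, ω=t-s, ϖ(x)=x², π={0,1/10,1}. *)

(* Defs.v *)
From HB Require Import structures.
From mathcomp Require Import all_boot all_order all_algebra.
From mathcomp Require Import all_classical all_reals all_analysis.

Set Implicit Arguments.
Unset Strict Implicit.
Unset Printing Implicit Defensive.

Import Order.TTheory GRing.Theory Num.Theory.
Import numFieldNormedType.Exports.

Local Open Scope classical_set_scope.
Local Open Scope ring_scope.

(* Functions on [0, T], on [0, +oo[ or on a simplex are represented by total
   functions, whose values outside of that domain are never constrained. *)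

Section simplices.
Context {R : realType}.
Implicit Types T r s t : R.

Definition simplex2 T s t : bool := [&& 0 <= s, s <= t & t <= T].

Definition simplex3 T r s t : bool := [&& 0 <= r, r <= s, s <= t & t <= T].

End simplices.

Section controls.
Context {R : realType}.

Record is_modulus (f : R -> R) : Prop := IsModulus {
  modulus_ge0 : forall x, 0 <= x -> 0 <= f x ;
  modulus_nd : forall x y, 0 <= x -> x <= y -> f x <= f y ;
  modulus0 : f 0 = 0 }.

(* Continuity close to the diagonal is continuity on a strip around it: as
   [0, T] is compact, any neighbourhood of the diagonal contains a strip. *)
Record is_control (T : R) (omega : R -> R -> R) : Prop := IsControl {
  control_ge0 : forall s t, simplex2 T s t -> 0 <= omega s t ;
  control_superadd : forall r s t, simplex3 T r s t ->
    omega r s + omega s t <= omega r t ;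
  control_diag : forall s, 0 <= s <= T -> omega s s = 0 ;
  control_continuous : exists2 e : R, 0 < e &
    {within [set p : R * R | simplex2 T p.1 p.2 /\ p.2 - p.1 < e],
      continuous (fun p : R * R => omega p.1 p.2)} }.

End controls.

Section almost_flows.
Context {R : realType} {V : completeNormedModType R}.
Implicit Types (T M K : R) (delta varpi : R -> R) (omega : R -> R -> R).
Implicit Types (chi phi : R -> R -> V -> V) (y : R -> V).

Definition osc (f : V -> V) (h : R) : \bar R :=
  ereal_sup [set (`|f p.1 - f p.2|)%:E | p in [set p : V * V | `|p.1 - p.2| <= h]].

Definition supnorm (f : V -> V) : \bar R :=
  ereal_sup [set (`|f x|)%:E | x in [set: V]].

(* A family (s, t) |-> chi_{t,s} is applied as [chi t s]. *)
Definition O_bound T delta varpi omega chi (C : R) : Prop :=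
  forall r s t l, simplex3 T r s t -> 0 <= l ->
    (osc (chi t s) (l * varpi (omega r s))
       <= (C * delta T * (1 + l) * varpi (omega r t))%:E)%E.

Definition class_O T delta varpi omega chi : Prop :=
  (forall s t, simplex2 T s t -> continuous (chi t s)) /\
  (exists2 C : R, 0 <= C & O_bound T delta varpi omega chi C).

Definition O_norm T delta varpi omega chi : \bar R :=
  ereal_inf [set C%:E | C in
    [set C : R | 0 <= C /\ O_bound T delta varpi omega chi C]].

Definition hatf phi : R -> R -> V -> V := fun t s x => phi t s x - x.

Record class_F T delta varpi omega phi : Prop := ClassF {
  F_class_O : class_O T delta varpi omega (hatf phi) ;
  F_O_norm : (O_norm T delta varpi omega (hatf phi) <= 1)%E ;
  F_supnorm : forall s t, simplex2 T s t ->
    (supnorm (hatf phi t s) <= (delta (t - s))%:E)%E }.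

Definition dphi phi (t s r : R) : V -> V :=
  fun x => phi t s (phi s r x) - phi t r x.

Definition almost_flow T delta varpi omega M phi : Prop :=
  class_F T delta varpi omega phi /\
  (forall r s t, simplex3 T r s t ->
    (supnorm (dphi phi t s r) <= (M * varpi (omega r t))%:E)%E).

Definition Cpath T : set (R -> V) :=
  [set y | {within `[0, T], continuous y}].

Definition P_K T varpi omega phi (a : V) K : set (R -> V) :=
  [set y | [/\ Cpath T y, y 0 = a &
    forall s t, simplex2 T s t ->
      `|y t - phi t s (y s)| <= K * varpi (omega s t)]].

Definition P_ T varpi omega phi (a : V) : set (R -> V) :=
  \bigcup_(K in [set K : R | 0 <= K]) P_K T varpi omega phi a K.

End almost_flows.

Section partitions.
Context {R : realType}.

(* A partition 0 = t_0 < ... < t_n = T is the sequence [:: t_1; ...; t_n],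
   subject to [itv_partition 0 T pi]. *)
Definition pt (pi : seq R) (k : nat) : R := nth 0 (0 :: pi) k.

(* Bounded below by 0: this is the supremum in [0, +oo[, which is 0 if
   no interval of pi is contained in [s, t]. The quotient is 0 when omega
   vanishes on the interval, in which case its numerator is 0 too. *)
Definition mu (varpi : R -> R) (omega : R -> R -> R) (pi : seq R)
    (s t : R) : R :=
  \big[Num.max/0]_(0 <= k < size pi | (s <= pt pi k) && (pt pi k.+1 <= t))
    (varpi (omega (pt pi k) (pt pi k.+1)) / omega (pt pi k) (pt pi k.+1)).

(* The fraction of [u, v] lying before t. *)
Definition frac_before (u v t : R) : R :=
  Num.max 0 (Num.min 1 ((t - u) / (v - u))).

Context {V : completeNormedModType R}.
Implicit Types (phi : R -> R -> V -> V) (y : R -> V).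

(* Piecewise affine in s and in t between the points of pi; see
   [Phi_pi_pt] for its values at these points. Off these points the affine
   interpolation ignores the time modulus of phi, so an error bound in terms
   of omega alone can only be expected when s and t belong to pi. *)
Definition Phi_pi phi (pi : seq R) y (s t : R) : V :=
  \sum_(0 <= k < size pi)
    (frac_before (pt pi k) (pt pi k.+1) t - frac_before (pt pi k) (pt pi k.+1) s)
      *: hatf phi (pt pi k.+1) (pt pi k) (y (pt pi k)).

Lemma pt_lt (T : R) pi i j : itv_partition 0 T pi ->
  (i < j)%N -> (j <= size pi)%N -> pt pi i < pt pi j.
Proof.
move=> [pi_path _] ij jn.
have pi_sorted : sorted <%R (0 :: pi) by [].
apply: (@sorted_ltn_nth _ _ lt_trans 0 _ pi_sorted) => //.
by rewrite inE /= ltnS (leq_trans (ltnW ij)).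
Qed.

Lemma frac_before_pt (T : R) pi k j : itv_partition 0 T pi ->
  (k < size pi)%N -> (j <= size pi)%N ->
  frac_before (pt pi k) (pt pi k.+1) (pt pi j) = (k < j)%N%:R.
Proof.
move=> piT kn jn; rewrite /frac_before.
have d_gt0 : 0 < pt pi k.+1 - pt pi k by rewrite subr_gt0 (pt_lt piT).
have [kj|jk] := ltnP k j.
- rewrite (min_idPl _) ?(max_idPr _) ?ler01//.
  rewrite ler_pdivlMr// mul1r lerD2r.
  by move: kj; rewrite leq_eqVlt => /predU1P[->//|kj]; rewrite ltW// (pt_lt piT).
- apply/max_idPl; rewrite ge_min; apply/orP; right.
  rewrite pmulr_lle0 ?invr_gt0// subr_le0.
  by move: jk; rewrite leq_eqVlt => /predU1P[->//|jk];
    rewrite ltW// (pt_lt piT)// ltnW.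
Qed.

Lemma Phi_pi_pt (T : R) phi pi y i j : itv_partition 0 T pi ->
  (i <= j)%N -> (j <= size pi)%N ->
  Phi_pi phi pi y (pt pi i) (pt pi j) =
  \sum_(i <= k < j) hatf phi (pt pi k.+1) (pt pi k) (y (pt pi k)).
Proof.
move=> piT ij jn; rewrite /Phi_pi.
rewrite (@big_cat_nat _ _ _ i)//= ?(leq_trans ij)//.
rewrite (@big_cat_nat _ _ _ j i)//=.
rewrite big_nat big1 ?add0r => [|k /andP[_ ki]]; last first.
  have kj := leq_trans ki ij; have kn := leq_trans kj jn.
  rewrite !(frac_before_pt piT)// ?(leq_trans ij)//.
  by rewrite ki kj subrr scale0r.
rewrite [X in _ + X]big_nat [X in _ + X]big1 ?addr0 => [|k /andP[jk kn]]; last first.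
  rewrite !(frac_before_pt piT)// ?(leq_trans ij)//.
  by rewrite !ltnNge jk (leq_trans ij jk) subrr scale0r.
rewrite big_nat [RHS]big_nat; apply: eq_bigr => k /andP[ik kj].
have kn := leq_trans kj jn.
rewrite !(frac_before_pt piT)// ?(leq_trans ij)//.
by rewrite kj ltnNge ik subr0 scale1r.
Qed.

End partitions.

(* Main.v *)
Require Import Defs.
From HB Require Import structures.
From mathcomp Require Import all_boot all_order all_algebra.
From mathcomp Require Import all_classical all_reals all_analysis.
From mathcomp Require Import ring lra.

Set Implicit Arguments.
Unset Strict Implicit.
Unset Printing Implicit Defensive.

Import Order.TTheory GRing.Theory Num.Theory.
Import numFieldNormedType.Exports.

Local Open Scope classical_set_scope.
Local Open Scope ring_scope.

(** The germ g(s, t) = hatphi_{t,s}(y_s) of a path y of P[phi, a, K] is almost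
additive. Writing hatphi_{t,s} at phi_{s,r}(y_r), which is within
K varpi(omega_{r,s}) of y_s, the definition of d phi gives
[|g(r,s) + g(s,t) - g(r,t)| <= (delta_T (1 + K) + M) varpi(omega_{r,t})]:
the first term is the oscillation of hatphi_{t,s}, the second one is d phi
([germ_defect]). The path Phi(y) is the additive function obtained from g by an
additive sewing lemma.

The heart of the sewing is [riemann_dist]: if the defect of g is at most
B varpi(omega), then along every chain of points the Riemann sum of g is within
A varpi(omega_{s,t}) of g(s,t), where A = 2 B / (1 - kappa). Cut the
chain at the step during which omega, counted from the left end, exceeds half
of omega_{s,t}. By superadditivity, both remaining pieces have at most half of
the control; they contribute at most 2 A varpi(omega_{s,t} / 2), hence at most
kappa A varpi(omega_{s,t}), and putting the pieces together costs two defects.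
The constant is the fixed point A = kappa A + 2 B.

The halving inequality on varpi also makes varpi(x) / x tend to 0
([modulus_small]), and omega is uniformly small near the diagonal
([control_small]), so the sum of varpi(omega) over a fine subdivision is small,
uniformly in its end points ([varpi_sum_small]). Every error is at most
a multiple of such a sum: the effect of refining a subdivision ([dyadic_sum_refine]), so that the
dyadic Riemann sums converge, and their lack of additivity
([dyadic_sum_defect]). The limit inherits the bound of [riemann_dist], which
gives [sewing_dist]; consistency on a partition follows by telescoping and
summing this bound over its intervals ([sum_varpi_le_mu]). *)

(** * Moduli and controls near zero *)

Lemma geometric_le {R : realType} (c z e : R) : 0 <= z < 1 -> 0 < e ->
  exists N, forall n, (N <= n)%N -> c * z ^+ n <= e.
Proof.
move=> /andP[z0 z1] e0.
have z_lt1 : `|z| < 1 by rewrite ger0_norm.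
have /cvgrPdist_le/(_ _ e0)[N _ HN] := cvg_geometric c z_lt1.
exists N => n /HN /=; rewrite sub0r normrN; exact: le_trans (ler_norm _).
Qed.

(** Each halving of x divides varpi(x) / x by at least 1 / kappa, and this
quotient is bounded on [0, 1]. *)
Lemma modulus_small {R : realType} (f : R -> R) (kappa : R) :
  is_modulus f -> 0 < kappa < 1 ->
  (forall x, 0 <= x -> 2 * f (x / 2) <= kappa * f x) ->
  forall e, 0 < e -> exists2 d, 0 < d & forall x, 0 <= x <= d -> f x <= e * x.
Proof.
move=> fm /andP[k0 k1] f_contr e e0.
have f_dbl x : 0 <= x -> 2 * f x <= kappa * f (2 * x).
  by move=> x0; have := f_contr (2 * x); rewrite mulrAC divff// mul1r; apply; lra.
have f1_ge0 : 0 <= f 1 by apply: modulus_ge0.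
pose C := 2 * f 1.
(* Induction on the number of doublings that bring x into ]1/2, 1]. *)
have f_far n x : 2^-1 ^+ n < x <= 1 -> f x <= C * x.
  elim: n x => [|n IHn] x /andP[xn x1]; first by move: xn; rewrite expr0; lra.
  have x0 : 0 < x by apply: le_lt_trans xn; apply: exprn_ge0; lra.
  have [xh|xh] := ltP (1 / 2) x.
    by have := modulus_nd fm (ltW x0) x1; rewrite /C; nra.
  have := f_dbl _ (ltW x0).
  have : f (2 * x) <= C * (2 * x).
    by apply: IHn; move: xn; rewrite exprS; lra.
  have : 0 <= f (2 * x) by apply: (modulus_ge0 fm); lra.
  nra.
have f_lin x : 0 <= x <= 1 -> f x <= C * x.
  move=> /andP[]; rewrite le_eqVlt => /predU1P[<- _|x0 x1].
    by rewrite (modulus0 fm) mulr0.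
  have [||N /(_ N (leqnn N))] := @geometric_le R 1 2^-1 (x / 2); [lra|lra|].
  by rewrite mul1r => xN; apply: (f_far N); lra.
have f_geo n x : 0 <= x <= 2^-1 ^+ n -> f x <= C * kappa ^+ n * x.
  elim: n x => [|n IHn] x /andP[x0 xn].
    by rewrite expr0 mulr1 f_lin// x0 -(expr0 2^-1).
  have := f_dbl _ x0.
  have : kappa * f (2 * x) <= kappa * (C * kappa ^+ n * (2 * x)).
    by rewrite ler_pM2l// IHn//; move: xn; rewrite exprS; lra.
  rewrite exprS; lra.
have [N /(_ N (leqnn N)) CN] :
    exists N, forall n, (N <= n)%N -> C * kappa ^+ n <= e.
  by apply: geometric_le => //; lra.
exists (2^-1 ^+ N); first by apply: exprn_gt0; lra.
move=> x xN; apply: le_trans (f_geo N x xN) _.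
by apply: ler_wpM2r => //; case/andP: xN.
Qed.

(** Continuity at each point (u, u), where omega vanishes, is made uniform in u
by the compactness of [0, T]. *)
Lemma control_small {R : realType} (T : R) omega : is_control T omega ->
  forall e, 0 < e -> exists2 d, 0 < d &
    forall s t, simplex2 T s t -> t - s <= d -> omega s t <= e.
Proof.
move=> omega_control e e0.
have [e1 e1_gt0 /subspace_continuousP omega_cont] :=
  control_continuous omega_control.
have /compact_near_coveringP covT : compact `[0, T] := @segment_compact R 0 T.
pose P (d s : R) := forall t, simplex2 T s t -> t - s <= d -> omega s t <= e.
have P_near u : `[0, T]%classic u -> \forall s \near u & d \near 0^'+, P d s.
  rewrite /= in_itv /= => uT.
  have uu : simplex2 T u u /\ u - u < e1 by rewrite /simplex2 lexx subrr.
  have /= := omega_cont (u, u) uu; move/cvgrPdist_le => /(_ _ e0).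
  rewrite /within /= nearE.
  move=> /nbhs_ballP[r /= r0 Hr].
  pose d0 := Num.min (r / 2) (e1 / 2).
  have d0_gt0 : 0 < d0 by rewrite lt_min; apply/andP; split; lra.
  exists (ball u (r / 2), [set d | d < d0]) => /=.
    split; first by apply: nbhsx_ballx; lra.
    by apply: nbhs_right_lt.
  move=> [s d] /= [us]; rewrite lt_min => /andP[dr de] t st tsd.
  have st' : s <= t by case/and3P: st.
  have Hst : ball (u, u) r (s, t) -> simplex2 T s t /\ t - s < e1 ->
    `|omega u u - omega s t| <= e := Hr (s, t).
  rewrite (control_diag omega_control uT) sub0r normrN in Hst.
  apply: le_trans (ler_norm _) (Hst _ _).
  - move: us; rewrite /ball /= => us; split => /=; first by rewrite /ball/=; lra.
    have : `|u - t| <= `|u - s| + `|s - t| by apply: ler_distD.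
    by rewrite (ler0_norm (x:=s-t)); rewrite /ball/=; lra.
  - by split => //; lra.
have [d [d_gt0 Pd]] : exists d, 0 < d /\ `[0, T] `<=` P d.
  near (0 : R)^'+ => d; exists d; split; near: d.
    exact: nbhs_right_gt.
  exact: covT P_near.
exists d => // s t st; apply: Pd => //=.
by rewrite in_itv /=; case/and3P: st => -> s_le_t /(le_trans s_le_t) ->.
Unshelve. all: by end_near. Qed.

(** * Chains of points and dyadic subdivisions *)

Section chains.
Context {R : realType}.
Implicit Types (T r s t : R) (x : nat -> R) (i j k m n : nat).

(** Repetitions are allowed, as truncating a subdivision to a smaller interval
creates some. *)
Definition chain T n x : Prop :=
  forall i j, (i <= j <= n)%N -> simplex2 T (x i) (x j).

Lemma chain_simplex3 T n x i j k : chain T n x -> (i <= j <= k)%N ->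
  (k <= n)%N -> simplex3 T (x i) (x j) (x k).
Proof.
move=> xT /andP[ij jk] kn.
have /and3P[xi xij _] : simplex2 T (x i) (x j).
  by apply: xT; rewrite ij (leq_trans jk).
have /and3P[_ xjk xk] : simplex2 T (x j) (x k) by apply: xT; rewrite jk.
by apply/and4P.
Qed.

Definition clamp s t u : R := Num.max s (Num.min t u).

Lemma clamp_itv s t u : s <= t -> s <= clamp s t u <= t.
Proof. by move=> st; rewrite /clamp le_max lexx ge_max st ge_min lexx. Qed.

Lemma clamp_homo s t : {homo clamp s t : u v / u <= v}.
Proof.
move=> u v uv; have uv' : Num.min t u <= Num.min t v.
  by rewrite le_min !ge_min lexx uv orbT.
by rewrite /clamp ge_max !le_max lexx uv' orbT.
Qed.

Lemma clamp_dist s t u v : s <= t -> u <= v ->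
  clamp s t v - clamp s t u <= v - u.
Proof.
move=> st uv; rewrite /clamp.
have [tu|ut] := leP t u; have [tv|vt] := leP t v.
- by case: (leP s t); lra.
- by case: (leP s t); case: (leP s v); lra.
- by case: (leP s t); case: (leP s u); lra.
- by case: (leP s v); case: (leP s u); lra.
Qed.

Definition dyadic T m k : R := T * k%:R / 2 ^+ m.

(** The dyadic subdivision of [0, T] truncated to [s, t]: for all s and t the
same dyadic points are used, so that the sums over [r, s], [s, t] and [r, t]
can be compared term by term. *)
Definition cut T m s t k : R := clamp s t (dyadic T m k).

Lemma cut_chain T m s t n : simplex2 T s t -> chain T n (cut T m s t).
Proof.
move=> /and3P[s0 st tT] i j /andP[ij _].
have /andP[si _] := clamp_itv (dyadic T m i) st.
have /andP[_ jt] := clamp_itv (dyadic T m j) st.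
apply/and3P; split; [exact: le_trans si|apply: clamp_homo|exact: le_trans tT].
apply: ler_wpM2r; first by rewrite invr_ge0 exprn_ge0.
by apply: ler_wpM2l; [lra|rewrite ler_nat].
Qed.

Lemma cut0 T m s t : simplex2 T s t -> cut T m s t 0 = s.
Proof.
move=> /and3P[s0 st _]; rewrite /cut /dyadic mulr0 mul0r /clamp.
by rewrite (min_idPr (le_trans s0 st)) (max_idPl s0).
Qed.

Lemma cut_end T m s t : simplex2 T s t -> cut T m s t (2 ^ m) = t.
Proof.
move=> /and3P[_ st tT]; rewrite /cut /dyadic natrX mulfK ?expf_neq0//.
by rewrite /clamp (min_idPl tT) (max_idPr st).
Qed.

Lemma cut_refine T m d s t k : cut T (m + d) s t (k * 2 ^ d) = cut T m s t k.
Proof.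
congr clamp; rewrite /dyadic natrM natrX exprD.
by field; rewrite !expf_neq0.
Qed.

Lemma clamp_minl r s t u : r <= s <= t -> clamp r s u = Num.min s (clamp r t u).
Proof.
move=> /andP[rs st]; rewrite /clamp.
have [tu|ut] := leP t u; last first.
  have [su|us] := leP s u; have [ru|ur] := leP r u;
    by rewrite ?(max_idPr rs) ?(min_idPl su)//; case: leP => //; lra.
rewrite (min_idPl (le_trans st tu)) (max_idPr (le_trans rs st)).
by rewrite (max_idPr rs) (min_idPl st).
Qed.

Lemma clamp_maxr r s t u : r <= s <= t -> clamp s t u = Num.max s (clamp r t u).
Proof. by move=> /andP[rs st]; rewrite /clamp maxA (max_idPl rs). Qed.

Lemma cut_mesh T m s t k : 0 <= T -> s <= t ->
  cut T m s t k.+1 - cut T m s t k <= T * 2^-1 ^+ m.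
Proof.
move=> T0 st; have m_gt0 : (2 : R) ^+ m != 0 by rewrite expf_neq0.
have -> : T * 2^-1 ^+ m = dyadic T m k.+1 - dyadic T m k.
  by rewrite /dyadic -addn1 natrD exprVn; field.
apply: clamp_dist => //; apply: ler_wpM2r; first by rewrite invr_ge0 exprn_ge0.
by apply: ler_wpM2l; rewrite // ler_nat.
Qed.

End chains.

(** * Superadditivity along a chain *)

Section control_theory.
Context {R : realType} (T : R) (omega : R -> R -> R).
Hypothesis omega_control : is_control T omega.
Implicit Types (r s t : R) (x : nat -> R) (i j k n : nat).

Lemma control_le_l r s t : simplex3 T r s t -> omega r s <= omega r t.
Proof.
move=> rst; apply: le_trans (control_superadd omega_control rst).
rewrite lerDl; apply: (control_ge0 omega_control).
by case/and4P: rst => r0 rs st tT; apply/and3P; split => //; exact: le_trans rs.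
Qed.

Lemma control_sum_le n x i j : chain T n x -> (i <= j <= n)%N ->
  \sum_(i <= k < j) omega (x k) (x k.+1) <= omega (x i) (x j).
Proof.
move=> xT; elim: j => [|j IHj] /andP[].
  rewrite leqn0 => /eqP-> _; rewrite big_geq//.
  by apply/(control_ge0 omega_control)/xT.
rewrite leq_eqVlt => /predU1P[<-|ij] jn.
  rewrite big_geq//; apply/(control_ge0 omega_control)/xT.
  by rewrite leqnn.
rewrite ltnS in ij.
rewrite big_nat_recr//=.
have ijj : (i <= j <= j.+1)%N by rewrite ij /=.
apply: le_trans (control_superadd omega_control (chain_simplex3 xT ijj jn)).
by rewrite lerD2r IHj// ij ltnW.
Qed.

End control_theory.

(** * The additive sewing lemma *)

Section sewing.
Context {R : realType} {V : completeNormedModType R}.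
Variables (T B kappa : R) (varpi : R -> R) (omega : R -> R -> R).
Variable g : R -> R -> V.
Hypothesis T_ge0 : 0 <= T.
Hypothesis B_ge0 : 0 <= B.
Hypothesis varpi_modulus : is_modulus varpi.
Hypothesis omega_control : is_control T omega.
Hypothesis kappa_itv : 0 < kappa < 1.
Hypothesis varpi_kappa :
  forall x, 0 <= x -> 2 * varpi (x / 2) <= kappa * varpi x.
Hypothesis g_diag : forall s, 0 <= s <= T -> g s s = 0.
Hypothesis g_defect : forall r s t, simplex3 T r s t ->
  `|g r s + g s t - g r t| <= B * varpi (omega r t).
Implicit Types (r s t : R) (x : nat -> R) (i j k m n : nat).

Definition riemann x i j : V := \sum_(i <= k < j) g (x k) (x k.+1).

Let A := 2 * B / (1 - kappa).

Let A_eq : A = A * kappa + 2 * B.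
Proof.
rewrite /A; field; case/andP: kappa_itv => _ k1.
by rewrite subr_eq0 gt_eqF.
Qed.

Let A_ge0 : 0 <= A.
Proof.
case/andP: kappa_itv => _ k1.
by apply: divr_ge0; [rewrite mulr_ge0|rewrite subr_ge0 ltW].
Qed.

(** The chain is cut into the step x_k, x_{k+1} that crosses the middle of the
control and the two chains around it, each of which has at most half of the
control. The bound reproduces itself since A = kappa A + 2 B. *)
Lemma riemann_dist n x i j : chain T n x -> (i <= j <= n)%N ->
  `|riemann x i j - g (x i) (x j)| <= A * varpi (omega (x i) (x j)).
Proof.
move=> xT; have [N] := ubnP (j - i).
elim: N i j => // N IHN i j jiN /andP[ij jn].
have w_ge0 k l : (k <= l <= n)%N -> 0 <= omega (x k) (x l).
  by move=> kl; apply/(control_ge0 omega_control)/xT.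
have xitv k : (k <= n)%N -> 0 <= x k <= T.
  move=> kn; have : simplex2 T (x k) (x k) by apply: xT; rewrite leqnn.
  by case/and3P => -> _ ->.
have v_ge0 k l : (k <= l <= n)%N -> 0 <= varpi (omega (x k) (x l)).
  by move=> kl; apply/(modulus_ge0 varpi_modulus)/w_ge0.
move: ij; rewrite leq_eqVlt => /predU1P[ij|ij].
  rewrite -ij /riemann big_geq// g_diag ?xitv// ?ij//.
  by rewrite subrr normr0 mulr_ge0// -ij v_ge0// ij leqnn.
set w := omega (x i) (x j).
have ijn : (i <= j <= n)%N by rewrite ltnW.
have w0 : 0 <= w := w_ge0 _ _ ijn.
pose P k := (i <= k < j)%N && (omega (x i) (x k) <= w / 2).
(* k is the last index below j before which at most half of w is used. *)
have exP : exists k, P k.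
  exists i; rewrite /P leqnn ij /= (control_diag omega_control) ?xitv//.
    by rewrite divr_ge0.
  by rewrite (leq_trans (ltnW ij)).
have ubP k : P k -> (k <= j)%N by case/andP => /andP[_ /ltnW].
case: (ex_maxnP exP ubP) => k /andP[/andP[ik kj] wik] kmax.
have kn : (k < n)%N := leq_trans kj jn.
have wkj : omega (x k.+1) (x j) <= w / 2.
  move: (kj); rewrite leq_eqVlt => /predU1P[->|k1j].
    by rewrite (control_diag omega_control) ?xitv// divr_ge0.
  have : w / 2 < omega (x i) (x k.+1).
    rewrite ltNge; apply/negP => wk1; have := kmax k.+1.
    by rewrite /P k1j wk1 leqW//= ltnn => /(_ isT).
  have := control_superadd omega_control (chain_simplex3 xT (_ : i <= k.+1 <= j)%N jn).
  by rewrite leqW// ltnW// -/w => /(_ isT); lra.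
have split3 : riemann x i j - g (x i) (x j) =
    (riemann x i k - g (x i) (x k)) + (riemann x k.+1 j - g (x k.+1) (x j))
    + ((g (x i) (x k) + g (x k) (x k.+1) - g (x i) (x k.+1))
    + (g (x i) (x k.+1) + g (x k.+1) (x j) - g (x i) (x j))).
  rewrite -[g (x i) (x k.+1) + _ - _]addrA subrKA addrACA !subrKA addrA.
  rewrite /riemann (@big_cat_nat _ _ _ k)//= ?(ltnW kj)//.
  by rewrite [X in _ + X - _]big_ltn// !addrA.
rewrite ltnS in jiN.
have kiN : (k - i < N)%N by rewrite (leq_trans _ jiN)// ltn_sub2r.
have jkN : (j - k.+1 < N)%N by rewrite (leq_trans _ jiN)// ltn_sub2l// ltnS.
have ikn : (i <= k <= n)%N by rewrite ik ltnW.
have kjn : (k.+1 <= j <= n)%N by rewrite kj.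
have ikk1 : (i <= k <= k.+1)%N by rewrite ik /=.
have ik1j : (i <= k.+1 <= j)%N by rewrite kj leqW.
have varpi_nd u v : 0 <= u -> u <= v -> B * varpi u <= B * varpi v.
  by move=> u0 uv; rewrite ler_wpM2l// (modulus_nd varpi_modulus).
have Dik : `|riemann x i k - g (x i) (x k)| <= A * varpi (w / 2).
  apply: le_trans (IHN i k kiN ikn) _.
  by rewrite ler_wpM2l// (modulus_nd varpi_modulus)// w_ge0.
have Dkj : `|riemann x k.+1 j - g (x k.+1) (x j)| <= A * varpi (w / 2).
  apply: le_trans (IHN k.+1 j jkN kjn) _.
  by rewrite ler_wpM2l// (modulus_nd varpi_modulus)// w_ge0.
have D1 : `|g (x i) (x k) + g (x k) (x k.+1) - g (x i) (x k.+1)| <= B * varpi w.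
  apply: le_trans (g_defect (chain_simplex3 xT ikk1 kn)) _.
  apply: varpi_nd; first by rewrite w_ge0// leqW.
  exact: (control_le_l omega_control (chain_simplex3 xT ik1j jn)).
have D2 : `|g (x i) (x k.+1) + g (x k.+1) (x j) - g (x i) (x j)| <= B * varpi w.
  exact: g_defect (chain_simplex3 xT ik1j jn).
have : A * (2 * varpi (w / 2)) <= A * (kappa * varpi w).
  by rewrite ler_wpM2l// varpi_kappa.
have := congr1 ( *%R^~ (varpi w)) A_eq => /=.
rewrite split3.
set X := riemann x i k - _; set Y := riemann x k.+1 j - _.
set Z := _ - g (x i) (x k.+1); set W := _ - g (x i) (x j).
have := ler_normD (X + Y) (Z + W).
have := ler_normD X Y; have := ler_normD Z W.
rewrite -/X -/Y -/Z -/W in Dik Dkj D1 D2.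
lra.
Qed.

Let full_range m : (0 <= 2 ^ m <= 2 ^ m)%N.
Proof. exact: leqnn. Qed.

(** Once the mesh is small, varpi(omega) is at most a small multiple of omega on
each interval, and omega is superadditive. *)
Lemma varpi_sum_small e : 0 < e -> exists N, forall m s t,
  (N <= m)%N -> simplex2 T s t ->
  \sum_(0 <= k < 2 ^ m) varpi (omega (cut T m s t k) (cut T m s t k.+1)) <= e.
Proof.
move=> e0; pose c := omega 0 T + 1.
(* Adding 1 keeps c positive when omega vanishes identically. *)
have c0 : 0 < c.
  by rewrite ltr_wpDl// (control_ge0 omega_control)// /simplex2 !lexx T_ge0.
have [d d0 varpi_d] :=
  modulus_small varpi_modulus kappa_itv varpi_kappa (divr_gt0 e0 c0).
have [h h0 omega_h] := control_small omega_control d0.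
have [N mesh_h] : exists N, forall n, (N <= n)%N -> T * 2^-1 ^+ n <= h.
  by apply: geometric_le => //; lra.
exists N => m s t Nm st; have cT n := @cut_chain _ T m s t n st.
have term k : varpi (omega (cut T m s t k) (cut T m s t k.+1)) <=
    e / c * omega (cut T m s t k) (cut T m s t k.+1).
  have kk1 : simplex2 T (cut T m s t k) (cut T m s t k.+1).
    by apply: (cT k.+1 k k.+1); rewrite leqnSn leqnn.
  apply: varpi_d; rewrite (control_ge0 omega_control kk1) omega_h//.
  by case/and3P: st => _ st _; apply: le_trans (mesh_h _ Nm); apply: cut_mesh.
apply: (@le_trans _ _ (\sum_(0 <= k < 2 ^ m)
    e / c * omega (cut T m s t k) (cut T m s t k.+1))).
  by apply: ler_sum => k _; exact: term.
rewrite -mulr_sumr.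
rewrite -[leRHS](mulfVK (lt0r_neq0 c0)).
rewrite ler_wpM2l ?divr_ge0 ?(ltW e0) ?(ltW c0)//.
apply: le_trans (control_sum_le omega_control (cT (2 ^ m)%N) (full_range m)) _.
rewrite cut0// cut_end//; case/and3P: st => s0 st tT.
have : omega s t <= omega 0 t.
  apply: le_trans (control_superadd omega_control (_ : simplex3 T 0 s t)).
    by rewrite lerDr (control_ge0 omega_control)// /simplex2 lexx s0 (le_trans st).
  by rewrite /simplex3 lexx s0 st.
have : omega 0 t <= omega 0 T.
  apply: (control_le_l omega_control).
  by rewrite /simplex3 !lexx (le_trans s0 st) tT.
by rewrite /c; lra.
Qed.

Definition dyadic_sum s t m : V := riemann (cut T m s t) 0 (2 ^ m).

Lemma dyadic_sum_dist s t m : simplex2 T s t ->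
  `|dyadic_sum s t m - g s t| <= A * varpi (omega s t).
Proof.
move=> st; have cT := @cut_chain _ T m s t (2 ^ m)%N st.
have := riemann_dist cT (full_range m).
by rewrite cut0// cut_end.
Qed.

(** The finer sum splits into one chain for each interval of the coarser
subdivision, to which [riemann_dist] applies. *)
Lemma dyadic_sum_refine s t m d : simplex2 T s t ->
  `|dyadic_sum s t (m + d) - dyadic_sum s t m| <=
  A * \sum_(0 <= k < 2 ^ m) varpi (omega (cut T m s t k) (cut T m s t k.+1)).
Proof.
move=> st; rewrite /dyadic_sum {1}/riemann expnD big_nat_mul /riemann.
rewrite -sumrB mulr_sumr; apply: le_trans (ler_norm_sum _ _ _) _.
apply: ler_sum => k _.
rewrite -(cut_refine T m d s t k) -(cut_refine T m d s t k.+1).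
have cT := @cut_chain _ T (m + d) s t (k.+1 * 2 ^ d)%N st.
have kk1 : (k * 2 ^ d <= k.+1 * 2 ^ d <= k.+1 * 2 ^ d)%N.
  by rewrite leqnn andbT leq_pmul2r ?expn_gt0.
exact: riemann_dist cT kk1.
Qed.

Lemma dyadic_sum_cvg s t : simplex2 T s t -> cvg (dyadic_sum s t @ \oo).
Proof.
move=> st; apply/cauchy_cvgP/cauchy_exP => e e0.
have eA : 0 < e / (A + 1) by rewrite divr_gt0// ltr_wpDl.
have [N sumN] := varpi_sum_small eA.
exists (dyadic_sum s t N); exists N => // n /= Nn.
rewrite -ball_normE /= distrC -(subnKC Nn).
apply: le_lt_trans (dyadic_sum_refine N (n - N) st) _.
apply: le_lt_trans (ler_wpM2l A_ge0 (sumN _ _ _ (leqnn N) st)) _.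
by rewrite mulrCA gtr_pMr// ltr_pdivrMr ?mul1r ?ltrDl// ltr_wpDl.
Qed.

(** The terms of the three sums cancel on every dyadic interval but the one that
has s in its interior, where a defect of g remains. Bounding every term by the
defect bound on its interval avoids locating s. *)
Lemma dyadic_sum_defect r s t m : simplex3 T r s t ->
  `|dyadic_sum r s m + dyadic_sum s t m - dyadic_sum r t m| <=
  B * \sum_(0 <= k < 2 ^ m) varpi (omega (cut T m r t k) (cut T m r t k.+1)).
Proof.
move=> /and4P[r0 rs st tT].
have rt : simplex2 T r t by rewrite /simplex2 r0 (le_trans rs st) tT.
rewrite /dyadic_sum /riemann -big_split -sumrB mulr_sumr.
apply: le_trans (ler_norm_sum _ _ _) _.
apply: ler_sum => k _.
have rst : r <= s <= t by rewrite rs st.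
rewrite /cut /= !(clamp_minl _ rst) !(clamp_maxr _ rst).
have : simplex2 T (cut T m r t k) (cut T m r t k.+1).
  by apply: (@cut_chain _ _ m _ _ k.+1 rt k k.+1); rewrite leqnSn leqnn.
rewrite /cut; move: (clamp _ _ _) (clamp _ _ _) => b a /and3P[a0 ab bT].
have gss : g s s = 0 by rewrite g_diag// (le_trans r0 rs) (le_trans st tT).
have vab : 0 <= B * varpi (omega a b).
  rewrite mulr_ge0// (modulus_ge0 varpi_modulus)//.
  by rewrite (control_ge0 omega_control)// /simplex2 a0 ab.
have [sa|as_] := leP s a; have [sb|bs] := leP s b.
- by rewrite gss add0r subrr normr0.
- by have := lt_le_trans bs (le_trans sa ab); rewrite ltxx.
- by apply: g_defect; rewrite /simplex3 a0 (ltW as_) sb bT.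
- by rewrite gss addr0 subrr normr0.
Qed.

Definition sewing t : V := lim (dyadic_sum 0 t @ \oo).

Lemma sewing_dist s t : simplex2 T s t ->
  `|sewing t - sewing s - g s t| <= A * varpi (omega s t).
Proof.
move=> st; have /and3P[s0 s_le_t tT] := st.
have st0 : simplex3 T 0 s t by rewrite /simplex3 lexx s0 s_le_t.
have cvg_s : dyadic_sum 0 s @ \oo --> sewing s.
  by apply: dyadic_sum_cvg; rewrite /simplex2 lexx s0 (le_trans s_le_t).
have t0 : simplex2 T 0 t by rewrite /simplex2 lexx tT (le_trans s0).
have cvg_t : dyadic_sum 0 t @ \oo --> sewing t by apply: dyadic_sum_cvg.
apply/ler_addgt0Pr => e e0.
have eB : 0 < e / (B + 1) by rewrite divr_gt0// ltr_wpDl.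
have [N sumN] := varpi_sum_small eB.
have cvg_u : `|dyadic_sum 0 t m - dyadic_sum 0 s m - g s t| @[m --> \oo] -->
    `|sewing t - sewing s - g s t|.
  by apply: cvg_norm; apply: cvgB; [exact: cvgB|exact: cvg_cst].
rewrite -(cvg_lim _ cvg_u)//; apply: limr_le.
  by apply/cvg_ex; eexists; exact: cvg_u.
exists N => // m /= Nm.
have -> : dyadic_sum 0 t m - dyadic_sum 0 s m - g s t =
    (dyadic_sum s t m - g s t) -
    (dyadic_sum 0 s m + dyadic_sum s t m - dyadic_sum 0 t m).
  by rewrite opprB opprD [RHS]addrC [dyadic_sum 0 t m + (- _ - _)]addrA subrKA.
apply: le_trans (ler_normB _ _) (lerD (dyadic_sum_dist m st) _).
apply: le_trans (dyadic_sum_defect m st0) _.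
apply: le_trans (ler_wpM2l B_ge0 (sumN _ _ _ Nm t0)) _.
by rewrite mulrCA ger_pMr// ler_pdivrMr ?mul1r ?lerDl// ltr_wpDl.
Qed.

End sewing.

Lemma eq_sewing {R : realType} {V : completeNormedModType R} (T : R)
    (g h : R -> R -> V) t : 0 <= t <= T ->
  (forall u v, simplex2 T u v -> g u v = h u v) -> sewing T g t = sewing T h t.
Proof.
move=> /andP[t0 tT] gh; rewrite /sewing.
suff -> : dyadic_sum T g 0 t = dyadic_sum T h 0 t by [].
apply/funext => m; apply: eq_bigr => k _; apply: gh.
have t_simplex : simplex2 T 0 t by rewrite /simplex2 lexx t0.
by apply: (cut_chain (n := k.+1) m t_simplex); rewrite leqnSn leqnn.
Qed.

(** * Sums over a partition *)

Section partition_estimates.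
Context {R : realType} (T : R) (pi : seq R).
Hypothesis piT : itv_partition 0 T pi.

Lemma pt_chain : chain T (size pi) (pt pi).
Proof.
have pt_le i j : (i <= j <= size pi)%N -> pt pi i <= pt pi j.
  move=> /andP[]; rewrite leq_eqVlt => /predU1P[->//|ij] jn.
  by rewrite ltW// (pt_lt piT).
have pt_end : pt pi (size pi) = T := itv_partition_nth_size 0 piT.
move=> i j /[dup] ijn /andP[ij jn]; apply/and3P; split.
- by apply: (pt_le 0%N); rewrite (leq_trans ij).
- exact: pt_le.
- by rewrite -pt_end pt_le// jn leqnn.
Qed.

Lemma varpi_le_mu varpi omega i j k : is_modulus varpi -> is_control T omega ->
  (i <= k < j)%N -> (j <= size pi)%N ->
  varpi (omega (pt pi k) (pt pi k.+1)) <=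
  mu varpi omega pi (pt pi i) (pt pi j) * omega (pt pi k) (pt pi k.+1).
Proof.
move=> varpiM omegaC /andP[ik kj] jn.
have kn : (k < size pi)%N := leq_trans kj jn.
have /and3P[_ sk _] : simplex2 T (pt pi i) (pt pi k).
  by apply: pt_chain; rewrite ik ltnW.
have /and3P[_ kt _] : simplex2 T (pt pi k.+1) (pt pi j).
  by apply: pt_chain; rewrite kj.
have kk1 : simplex2 T (pt pi k) (pt pi k.+1) by apply: pt_chain; rewrite leqnSn.
have := control_ge0 omegaC kk1; rewrite le_eqVlt => /predU1P[<-|w_gt0].
  by rewrite (modulus0 varpiM) mulr0.
rewrite -ler_pdivrMr// /mu big_mkord.
by apply: (le_bigmax_cond 0 _ (j := Ordinal kn)); rewrite /= sk kt.
Qed.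

Lemma sum_varpi_le_mu varpi omega i j : is_modulus varpi -> is_control T omega ->
  (i <= j <= size pi)%N ->
  \sum_(i <= k < j) varpi (omega (pt pi k) (pt pi k.+1)) <=
  mu varpi omega pi (pt pi i) (pt pi j) * omega (pt pi i) (pt pi j).
Proof.
move=> varpiM omegaC ijn; have /andP[_ jn] := ijn.
apply: (@le_trans _ _ (mu varpi omega pi (pt pi i) (pt pi j) *
    \sum_(i <= k < j) omega (pt pi k) (pt pi k.+1))).
  by rewrite mulr_sumr; apply: ler_sum_nat => k ikj; apply: varpi_le_mu.
apply: ler_wpM2l; last exact: (control_sum_le omegaC pt_chain ijn).
by rewrite /mu big_mkord bigmax_ge_id.
Qed.

Lemma mem_pt s : s \in 0 :: pi -> exists2 i, (i <= size pi)%N & s = pt pi i.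
Proof. by move=> /(nthP 0)[i i_lt <-]; exists i. Qed.

End partition_estimates.

(** * The germ of a path along an almost flow *)

Section almost_flow_germ.
Context {R : realType} {V : completeNormedModType R}.
Variables (T M : R) (delta varpi : R -> R) (omega : R -> R -> R).
Variable phi : R -> R -> V -> V.
Hypothesis T_ge0 : 0 <= T.
Hypothesis delta_modulus : is_modulus delta.
Hypothesis varpi_modulus : is_modulus varpi.
Hypothesis omega_control : is_control T omega.
Hypothesis phi_flow : almost_flow T delta varpi omega M phi.

(** The infimum that defines the norm of class O is attained. *)
Lemma hatf_osc_le r s t l (u v : V) : simplex3 T r s t -> 0 <= l ->
  `|u - v| <= l * varpi (omega r s) ->
  `|hatf phi t s u - hatf phi t s v| <= delta T * (1 + l) * varpi (omega r t).
Proof.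
move=> rst l0 uv; set d := `|_ - _|; set q := delta T * _ * _.
have [phiF _] := phi_flow.
(* Each admissible constant C gives d <= C q; it remains to pass to the
   infimum of these constants, dividing by q when q is positive. *)
have dC C : O_bound T delta varpi omega (hatf phi) C -> d <= C * q.
  move=> /(_ r s t l rst l0) oscC; rewrite /q 2!mulrA -lee_fin.
  by apply: le_trans oscC; apply: ereal_sup_ubound; exists (u, v).
have q0 : 0 <= q.
  have /and4P[r0 rs st tT] := rst.
  rewrite /q !mulr_ge0//; [exact: modulus_ge0|lra|].
  apply: (modulus_ge0 varpi_modulus); apply: (control_ge0 omega_control).
  by rewrite /simplex2 r0 (le_trans rs).
move: q0; rewrite le_eqVlt => /predU1P[q0|q_gt0].
  have [_ [C _ /dC]] := F_class_O phiF.
  by rewrite -q0 mulr0.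
have : d / q <= 1.
  rewrite -lee_fin; apply: le_trans (F_O_norm phiF).
  apply: le_ereal_inf_tmp => _ [C [_ /dC dCq] <-].
  by rewrite lee_fin ler_pdivrMr.
by rewrite ler_pdivrMr// mul1r.
Qed.

Lemma hatf_diag s (x : V) : 0 <= s <= T -> hatf phi s s x = 0.
Proof.
move=> /andP[s0 sT]; have [phiF _] := phi_flow.
have ss : simplex2 T s s by rewrite /simplex2 s0 lexx.
have := F_supnorm phiF ss; rewrite subrr (modulus0 delta_modulus) => sup0.
apply/eqP; rewrite -normr_le0 -lee_fin; apply: le_trans sup0.
by apply: ereal_sup_ubound; exists x.
Qed.

(** phi_{t,s}(phi_{s,r}(y_r)) expands to y_r + hatphi_{s,r}(y_r) +
hatphi_{t,s}(phi_{s,r}(y_r)), so the defect is d phi plus the difference of the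
values of hatphi_{t,s} at y_s and at phi_{s,r}(y_r). *)
Lemma germ_defect K (y : R -> V) : 0 <= K ->
  (forall s t, simplex2 T s t ->
      `|y t - phi t s (y s)| <= K * varpi (omega s t)) ->
  forall r s t, simplex3 T r s t ->
  `|hatf phi s r (y r) + hatf phi t s (y s) - hatf phi t r (y r)|
    <= (delta T * (1 + K) + M) * varpi (omega r t).
Proof.
move=> K0 yK r s t rst; have [_ /(_ r s t rst) dphiM] := phi_flow.
have d_le : `|dphi phi t s r (y r)| <= M * varpi (omega r t).
  by rewrite -lee_fin; apply: le_trans dphiM; apply: ereal_sup_ubound; exists (y r).
have -> : hatf phi s r (y r) + hatf phi t s (y s) - hatf phi t r (y r) =
    (hatf phi t s (y s) - hatf phi t s (phi s r (y r))) + dphi phi t s r (y r).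
  rewrite /dphi; move: (hatf phi t s (y s)) => c.
  by rewrite /hatf !opprB [LHS]addrAC subrKA -[RHS]addrA subrKA addrC.
rewrite mulrDl; apply: le_trans (ler_normD _ _) (lerD _ d_le).
apply: (hatf_osc_le rst K0); apply: yK.
by case/and4P: rst => r0 rs st tT; rewrite /simplex2 r0 rs (le_trans st).
Qed.

(** For z = Phi(y) the increments of y are the only source of continuity in
time: the bound of hatphi_{t,s} by delta(t - s) does not tend to 0 with t - s
when delta is discontinuous at 0. *)
Lemma continuous_of_increments K (y z : R -> V) : 0 <= K ->
  (forall e, 0 < e -> exists2 d, 0 < d & forall x, 0 <= x <= d -> varpi x <= e) ->
  Cpath T y ->
  (forall s t, simplex2 T s t ->
      `|z t - z s| <= `|y t - y s| + K * varpi (omega s t)) ->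
  Cpath T z.
Proof.
move=> K0 varpi_small /subspace_continuousP y_cont zy.
apply/subspace_continuousP => u /= uT; apply/cvgrPdist_le => e e0.
have e2 : 0 < e / 2 by rewrite divr_gt0.
have /cvgrPdist_le/(_ _ e2) yu := y_cont u uT.
have K1 : 0 < K + 1 by rewrite ltr_wpDl.
have [d d0 varpi_d] := varpi_small _ (divr_gt0 e2 K1).
have [h h0 omega_h] := control_small omega_control d0.
have zy_le s t : simplex2 T s t -> t - s <= h -> `|y t - y s| <= e / 2 ->
    `|z t - z s| <= e.
  move=> st ts yts; apply: le_trans (zy s t st) _.
  have w_ge0 := control_ge0 omega_control st.
  have v_ge0 := modulus_ge0 varpi_modulus w_ge0.
  have : varpi (omega s t) <= e / 2 / (K + 1) by rewrite varpi_d// w_ge0 omega_h.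
  rewrite ler_pdivlMr//; lra.
have near_h : \forall t \near within `[0, T] (nbhs u), `|u - t| < h.
  by apply: cvg_within; apply: nbhsx_ballx.
have near_T : \forall t \near within `[0, T] (nbhs u), 0 <= t <= T.
  by apply: withinT.
near=> t.
have tT : 0 <= t <= T by near: t.
have ut : `|u - t| < h by near: t.
have yut : `|y u - y t| <= e / 2 by near: t; exact: yu.
rewrite in_itv /= in uT.
case/andP: uT => u0 uT; case/andP: tT => t0 tT.
have [u_le_t|t_lt_u] := leP u t.
  rewrite distrC; apply: zy_le; first by rewrite /simplex2 u0 u_le_t.
    by apply/ltW/(le_lt_trans _ ut); rewrite distrC ler_norm.
  by rewrite distrC.
apply: zy_le => //; first by rewrite /simplex2 t0 ltW.
by apply/ltW/(le_lt_trans _ ut); rewrite ler_norm.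
Unshelve. all: by end_near. Qed.

End almost_flow_germ.

(** * The additive functional of an almost flow *)

Theorem corollary1 (R : realType) (V : completeNormedModType R) (T : R)
    (delta varpi : R -> R) (omega : R -> R -> R) (kappa M : R)
    (phi : R -> R -> V -> V) (a : V)
    (T_gt0 : 0 < T)
    (delta_modulus : is_modulus delta)
    (varpi_modulus : is_modulus varpi)
    (omega_control : is_control T omega)
    (kappa_itv : 0 < kappa < 1)
    (varpi_kappa : forall x, 0 <= x -> 2 * varpi (x / 2) <= kappa * varpi x)
    (kappa_delta : kappa + 2 * delta T < 1)
    (M_ge0 : 0 <= M)
    (phi_flow : almost_flow T delta varpi omega M phi) :
  exists Phi : (R -> V) -> (R -> V),
    [/\ (* Phi is a map from P[phi, a] to C([0, T], V) *)
        forall y, P_ T varpi omega phi a y -> Cpath T (Phi y),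
        (* Phi y depends only on the restriction of y to [0, T] *)
        forall y z, P_ T varpi omega phi a y -> P_ T varpi omega phi a z ->
          {in `[0, T], y =1 z} -> {in `[0, T], Phi y =1 Phi z} &
        forall (pi : seq R), itv_partition 0 T pi ->
        forall (K : R), 0 <= K ->
        forall y, P_K T varpi omega phi a K y ->
        let A := 2 * (delta T * (1 + K) + M) / (1 - kappa) in
        let Phi_ (s t : R) := Phi y t - Phi y s in
        [/\ forall s t, simplex2 T s t ->
              `|Phi_ s t - hatf phi t s (y s)| <= A * varpi (omega s t),
            (* s and t range over the points of the partition *)
            forall s t, s \in 0 :: pi -> t \in 0 :: pi -> simplex2 T s t ->
              `|Phi_ s t - Phi_pi phi pi y s t|
                <= A * mu varpi omega pi s t * omega s t &
            forall r s t, simplex3 T r s t ->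
              Phi_ r s + Phi_ s t = Phi_ r t]].
Proof.
have T_ge0 := ltW T_gt0.
pose germ (y : R -> V) s t := hatf phi t s (y s).
pose A K := 2 * (delta T * (1 + K) + M) / (1 - kappa).
have B_ge0 K : 0 <= K -> 0 <= delta T * (1 + K) + M.
  by move=> K0; rewrite addr_ge0// mulr_ge0 ?(modulus_ge0 delta_modulus)// addr_ge0.
have A_ge0 K : 0 <= K -> 0 <= A K.
  move=> /B_ge0 B0; rewrite /A divr_ge0 ?mulr_ge0//.
  by case/andP: kappa_itv => _ k1; rewrite subr_ge0 ltW.
have Phi_dist K y : 0 <= K -> P_K T varpi omega phi a K y -> forall s t,
    simplex2 T s t -> `|sewing T (germ y) t - sewing T (germ y) s - germ y s t|
      <= A K * varpi (omega s t).
  move=> K0 [_ _ yK] s t st.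
  apply: (sewing_dist T_ge0 (B_ge0 K K0) varpi_modulus omega_control kappa_itv
    varpi_kappa _ _ st).
    by move=> u uT; apply: (hatf_diag delta_modulus phi_flow).
  exact: (germ_defect T_ge0 delta_modulus varpi_modulus omega_control
    phi_flow K0 yK).
exists (fun y => sewing T (germ y)); split.
- move=> y [K K0 yP]; have [y_cont _ yK] := yP.
  apply: (continuous_of_increments varpi_modulus omega_control
    (addr_ge0 (A_ge0 _ K0) K0) _ y_cont).
    move=> e e0.
    have [d d0 varpi_d] :=
      modulus_small varpi_modulus kappa_itv varpi_kappa (ltr01 : 0 < 1 :> R).
    exists (Num.min d e); first by rewrite lt_min d0.
    move=> x /andP[x0]; rewrite le_min => /andP[xd xe].
    by apply: le_trans (varpi_d x _) _; rewrite ?x0// mul1r.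
  move=> s t st; have := Phi_dist K y K0 yP s t st; have := yK s t st.
  set Z := sewing _ _ t - _ => h1 h2.
  (* phi_{t,s}(y_s) = y_s + g(s, t), so that Z is y_t - y_s up to an error of
     order varpi(omega_{s,t}). *)
  have -> : Z = (Z - germ y s t) + (y t - y s) - (y t - phi t s (y s)).
    rewrite /germ /hatf !opprB -[RHS]addrA [_ + (_ - y t)]addrC subrKA.
    by rewrite -addrA subrKA subrr addr0.
  have h3 := ler_normB ((Z - germ y s t) + (y t - y s)) (y t - phi t s (y s)).
  have h4 := ler_normD (Z - germ y s t) (y t - y s).
  lra.
- move=> y z _ _ yz t; rewrite in_itv /= => /andP[t0 tT].
  apply: eq_sewing => [|u v /and3P[u0 uv vT]]; first by rewrite t0.
  by rewrite /germ yz// in_itv /= u0 (le_trans uv).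
- move=> pi piT K K0 y yP; split.
  + exact: Phi_dist.
  + move=> _ _ /mem_pt[i iN ->] /mem_pt[j jN ->] /and3P[_ st _].
    have ij : (i <= j)%N.
      by rewrite leqNgt; apply/negP => /(pt_lt piT)/(_ iN); rewrite ltNge st.
    rewrite (Phi_pi_pt _ _ piT)//.
    rewrite -(telescope_sumr (fun k => sewing T (germ y) (pt pi k)) ij) -sumrB.
    rewrite -mulrA; have ijn : (i <= j <= size pi)%N by rewrite ij.
    have mu_le := sum_varpi_le_mu piT varpi_modulus omega_control ijn.
    apply: le_trans (ler_wpM2l (A_ge0 _ K0) mu_le).
    rewrite mulr_sumr; apply: le_trans (ler_norm_sum _ _ _) _.
    apply: ler_sum_nat => k /andP[_ kj]; apply: Phi_dist => //.
    by apply: (pt_chain piT); rewrite leqnSn (leq_trans kj).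
  + by move=> r s t _; rewrite addrC subrKA.
Qed.
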